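(* Let $G_1,G_2,G_k$ be generators over $\Sigma_1,\Sigma_2,\Sigma_k$, respectively, with $\Sigma_1\cap\Sigma_2\subseteq\Sigma_k\subseteq\Sigma_1\cup\Sigma_2$ and $L(G_k)\subseteq P_k(L(G_1))\parallel P_k(L(G_2))$. Let $K\subseteq L_m(G_1\| G_2\| G_k)$ be a specification such that both $K$ and its prefix closure $\overline{K}$ are conditionally decomposable with respect to $\Sigma_1,\Sigma_2,\Sigma_k$. Define \[ \sup C_k=\sup C(P_k(K),L(G_k),\Sigma_{k,u}),\qquad \sup C_{i+k}=\sup C\big(P_{i+k}(K),\,L(G_i)\parallel\overline{\sup C_k},\,\Sigma_{i+k,u}\big),\quad i=1,2. \] Assume that $\sup C_{1+k}$ and $\sup C_{2+k}$ are nonconflicting. Assume that, for $i=1,2$, the projection $P^{i+k}_k:(\Sigma_i\cup\Sigma_k)^*\to\Sigma_k^*$ is a $(P^{i+k}_i)^{-1}(L(G_i))$-observer, and that either for both $i=1,2$ it is OCC for $(P^{i+k}_i)^{-1}(L(G_i))$, or for both $i=1,2$ it is LCC for $(P^{i+k}_i)^{-1}(L(G_i))$. Then $P^{1+k}_k(\sup C_{1+k})\cap P^{2+k}_k(\sup C_{2+k})$ is controllable with respect to $L(G_k)$ and $\Sigma_{k,u}$.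
   Context: An event set is a finite nonempty set $\Sigma$; a language over $\Sigma$ is a subset of the set $\Sigma^*$ of finite words, and the specification $K$ is a regular language. $\overline{L}$ denotes the prefix closure of $L$. A generator over $\Sigma$ is $G=(Q,\Sigma,f,q_0,Q_m)$ with finite nonempty state set $Q$, partial transition function $f:Q\times\Sigma\to Q$ (extended to words), initial state $q_0$, marked states $Q_m\subseteq Q$; $L(G)=\{s\in\Sigma^*: f(q_0,s)\text{ is defined}\}$ and $L_m(G)=\{s\in\Sigma^*: f(q_0,s)\in Q_m\}$. For $\Sigma_0\subseteq\Sigma$, the projection $\Sigma^*\to\Sigma_0^*$ is the homomorphism erasing events outside $\Sigma_0$ and fixing those in $\Sigma_0$. For $L_i\subseteq\Sigma_i^*$, $L_1\parallel L_2=\{w\in(\Sigma_1\cup\Sigma_2)^*: P_i(w)\in L_i,\ i=1,2\}$, where $P_i$ is the projection to $\Sigma_i^*$. $G_1\|G_2$ is the parallel composition of generators, with $L(G_1\|G_2)=L(G_1)\parallel L(G_2)$ and $L_m(G_1\|G_2)=L_m(G_1)\parallel L_m(G_2)$. Languages $L_1,L_2$ are nonconflicting if $\overline{L_1\parallel L_2}=\overline{L_1}\parallel\overline{L_2}$. The set $\Sigma_1\cup\Sigma_2$ is partitioned into controllable events $\Sigma_c$ and uncontrollable events $\Sigma_u$. Notation, for $i=1,2$: $\Sigma_{i+k}=\Sigma_i\cup\Sigma_k$; $\Sigma_{j,u}=\Sigma_j\cap\Sigma_u$ for $j\in\{k,1+k,2+k\}$; $P_k:(\Sigma_1\cup\Sigma_2)^*\to\Sigma_k^*$,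 $P_{i+k}:(\Sigma_1\cup\Sigma_2)^*\to\Sigma_{i+k}^*$, $P^{i+k}_k:\Sigma_{i+k}^*\to\Sigma_k^*$ and $P^{i+k}_i:\Sigma_{i+k}^*\to\Sigma_i^*$ are projections. $P_k(L(G_i))$ is regarded as a language over $\Sigma_i\cap\Sigma_k$. A language $K\subseteq(\Sigma_1\cup\Sigma_2)^*$ is conditionally decomposable with respect to $\Sigma_1,\Sigma_2,\Sigma_k$ if $K=P_{1+k}(K)\parallel P_{2+k}(K)$. A language $M$ is controllable with respect to a prefix-closed language $L$ and a set of uncontrollable events $\Sigma'_u$ if $\overline{M}\Sigma'_u\cap L\subseteq\overline{M}$. $\sup C(K,L,\Sigma'_u)$ denotes the supremal controllable sublanguage of $K$: the union (which is itself controllable) of all $M\subseteq K\cap L$ controllable with respect to $L$ and $\Sigma'_u$. Let $P:\Sigma^*\to\Sigma_0^*$ be a projection, $\Sigma_0\subseteq\Sigma$. Observer: $P$ is an $L$-observer for $L\subseteq\Sigma^*$ if for all $t\in P(L)$ and $s\in\overline{L}$, if $P(s)$ is a prefix of $t$ then there is $u\in\Sigma^*$ with $su\in L$ and $P(su)=t$. OCC (output control consistent): $P$ is OCC for $L\subseteq\Sigma^*$ if for every $s\in\overline{L}$ of the form $s=\sigma_1\cdots\sigma_\ell$ or $s=s'\sigma_0\sigma_1\cdots\sigma_\ell$, $\ell\ge1$, where $s'\in\Sigma^*$, $\sigma_0,\sigma_\ell\in\Sigma_0$ and $\sigma_i\in\Sigma\setminus\Sigma_0$ for $i=1,\dots,\ell-1$: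 if $\sigma_\ell\in\Sigma_u$, then $\sigma_i\in\Sigma_u$ for all $i=1,\dots,\ell-1$. LCC (locally control consistent): for a prefix-closed $L\subseteq\Sigma^*$, $P$ is LCC with respect to a word $s\in L$ if for all $\sigma_u\in\Sigma_0\cap\Sigma_u$ with $P(s)\sigma_u\in P(L)$, either there is no $u\in(\Sigma\setminus\Sigma_0)^*$ with $su\sigma_u\in L$, or there is $u\in(\Sigma_u\setminus\Sigma_0)^*$ with $su\sigma_u\in L$; $P$ is LCC for $L$ if it is LCC with respect to every $s\in L$. *)

(* Defs.v *)
#[export] Set Warnings "-notation-overridden".
From mathcomp Require Export all_boot.
From mathcomp Require Export boolp classical_sets.

Set Implicit Arguments.
Unset Strict Implicit.
Unset Printing Implicit Defensive.

Local Open Scope classical_set_scope.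

(** Event sets are subsets [S : {set A}] of an ambient finite type [A], words
    are sequences over [A], and a language is a set of words.  Since all words
    live in the same type, operations that depend on the alphabets take them
    as explicit arguments. *)

Section Languages.
Variable A : finType.
Implicit Types (S Sk Su : {set A}) (s t u v w : seq A) (a : A).
Implicit Types (K L M : set (seq A)).

Definition words S : set (seq A) := [set w | all [in S] w].

Definition pclos L : set (seq A) := [set s | exists2 w, L w & prefix s w].

Definition proj S w : seq A := [seq a <- w | a \in S].

(** Inverse image of [L] under the projection from [words S] to [words S0]. *)
Definition invproj S S0 L : set (seq A) := words S `&` proj S0 @^-1` L.

Definition lpar S1 S2 L1 L2 : set (seq A) :=
  [set w | [/\ words (S1 :|: S2) w, L1 (proj S1 w) & L2 (proj S2 w)]].

(** [L1] and [L2] are languages over [S1] and [S2] respectively. *)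
Definition nonconflicting S1 S2 L1 L2 : Prop :=
  pclos (lpar S1 S2 L1 L2) = lpar S1 S2 (pclos L1) (pclos L2).

Definition cond_decomposable S1 S2 Sk K : Prop :=
  K = lpar (S1 :|: Sk) (S2 :|: Sk)
        (proj (S1 :|: Sk) @` K) (proj (S2 :|: Sk) @` K).

Definition controllable M L Su : Prop :=
  [set rcons s a | s in pclos M & a in [set` Su]] `&` L `<=` pclos M.

Definition supC K L Su : set (seq A) :=
  \bigcup_(M in [set M | M `<=` K `&` L /\ controllable M L Su]) M.

(** In the next three definitions the projection is the one from [words S] to
    [words S0], with [S0 \subset S], and [L] is a language over [S]. *)

Definition observer S S0 L : Prop :=
  forall t s, (proj S0 @` L) t -> pclos L s -> prefix (proj S0 s) t ->
  exists u, [/\ words S u, L (s ++ u) & proj S0 (s ++ u) = t].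

(** [v] is the (possibly empty) block of events outside [S0] that precedes the
    last event [a]; [a0] is the event of [S0] just before this block, if any. *)
Definition OCC S S0 Su L : Prop :=
  forall s v a, pclos L s ->
    s = rcons v a \/
      (exists s' a0, [/\ words S s', a0 \in S0 & s = s' ++ a0 :: rcons v a]) ->
    words (S :\: S0) v -> a \in S0 ->
  a \in Su -> words Su v.

Definition LCC_at S S0 Su L s : Prop :=
  forall a, a \in S0 :&: Su -> (proj S0 @` L) (rcons (proj S0 s) a) ->
  ~ (exists2 u, words (S :\: S0) u & L (s ++ rcons u a)) \/
  (exists2 u, words (Su :\: S0) u & L (s ++ rcons u a)).

Definition LCC S S0 Su L : Prop := forall s, L s -> LCC_at S S0 Su L s.

End Languages.

(** The partial transition function is total on [A] with values in [option],
    and undefined on the events outside [S]. *)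
Record generator (A : finType) (S : {set A}) := Generator {
  state :> finType;
  trans : state -> A -> option state;
  init : state;
  marked : {set state};
  trans_out : forall q a, a \notin S -> trans q a = None
}.

Section Generators.
Variable A : finType.

Fixpoint run (S : {set A}) (G : generator S) (q : G) (w : seq A) : option G :=
  if w is a :: w' then obind (fun q' => run q' w') (trans q a) else Some q.

Definition lang (S : {set A}) (G : generator S) : set (seq A) :=
  [set w | isSome (run (init G) w)].

Definition mlang (S : {set A}) (G : generator S) : set (seq A) :=
  [set w | exists2 q, run (init G) w = Some q & q \in marked G].

Definition regular (S : {set A}) (L : set (seq A)) : Prop :=
  exists G : generator S, mlang G = L.

Section Composition.
Variables (S1 S2 : {set A}) (G1 : generator S1) (G2 : generator S2).

Definition gpar_trans (q : G1 * G2) (a : A) : option (G1 * G2) :=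
  match a \in S1, a \in S2 with
  | true, true =>
      obind (fun q1 => omap (pair q1) (trans q.2 a)) (trans q.1 a)
  | true, false => omap (fun q1 => (q1, q.2)) (trans q.1 a)
  | false, true => omap (fun q2 => (q.1, q2)) (trans q.2 a)
  | false, false => None
  end.

Lemma gpar_trans_out q a : a \notin S1 :|: S2 -> gpar_trans q a = None.
Proof.
by rewrite finset.in_setU negb_or /gpar_trans => /andP[/negbTE -> /negbTE ->].
Qed.

Definition gpar : generator (S1 :|: S2) :=
  Generator (init G1, init G2) (finset.setX (marked G1) (marked G2))
    gpar_trans_out.

Lemma run_gpar q1 q2 r1 r2 w :
  run (G := gpar) (q1, q2) w = Some (r1, r2) <->
  [/\ words (S1 :|: S2) w, run q1 (proj S1 w) = Some r1
    & run q2 (proj S2 w) = Some r2].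
Proof.
elim: w q1 q2 => [|a w IH] q1 q2.
  by rewrite /words /=; split=> [[-> ->]//|[_ [->] [->]]].
rewrite /words /= finset.in_setU /gpar_trans /=.
case: (a \in S1); case: (a \in S2) => /=; last by split=> // -[].
- case: (trans q1 a) => [p1|] /=; last by split=> // -[].
  by case: (trans q2 a) => [p2|] /=; [exact: IH | split=> // -[]].
- by case: (trans q1 a) => [p1|] /=; [exact: IH | split=> // -[]].
- by case: (trans q2 a) => [p2|] /=; [exact: IH | split=> // -[]].
Qed.

Lemma lang_gpar : lang gpar = lpar S1 S2 (lang G1) (lang G2).
Proof.
apply/seteqP; split=> w; rewrite /lang /lpar /=.
  case E: (run _ w) => [[r1 r2]|//] _.
  by move/run_gpar: E => [? -> ->].
case=> Sw.
case E1: (run _ _) => [r1|//] _; case E2: (run _ _) => [r2|//] _.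
by have /run_gpar -> : [/\ words (S1 :|: S2) w,
  run (init G1) (proj S1 w) = Some r1 & run (init G2) (proj S2 w) = Some r2].
Qed.

Lemma mlang_gpar : mlang gpar = lpar S1 S2 (mlang G1) (mlang G2).
Proof.
apply/seteqP; split=> w; rewrite /mlang /lpar /=.
  case=> -[r1 r2] /run_gpar[Sw E1 E2]; rewrite finset.in_setX => /andP[m1 m2].
  by split=> //; [exists r1 | exists r2].
case=> Sw [r1 E1 m1] [r2 E2 m2]; exists (r1, r2); first exact/run_gpar.
by rewrite finset.in_setX m1.
Qed.

End Composition.
End Generators.

(* Main.v *)
Require Import Defs.

Set Implicit Arguments.
Unset Strict Implicit.
Unset Printing Implicit Defensive.
Local Open Scope classical_set_scope.

(** The natural projection to [Sk] sends the two local supervisors to languages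
    whose closures meet exactly in the closure of the intersection: this is
    where nonconflictingness enters ([pclos_setI_proj]), through the fact that
    two words agreeing on their common events can be interleaved
    ([merge_words]).  It therefore suffices to show, for each component
    separately, that if [s] is a word of the closed local supervisor and [a] an
    uncontrollable event of [Sk] that the coordinator allows after [proj Sk s],
    then [rcons (proj Sk s) a] is again the projection of such a word.

    The coordinator's own supervisor allows [a] as well, being controllable, and
    the hypothesis on the language of the coordinator says that some word of the
    local plant projects to [rcons (proj Sk s) a].  By the observer property, [s]
    itself can be continued in the plant to a word with that projection, that is,
    by a block of local events followed by [a]; local control consistency allows
    one to choose the block uncontrollable.  Controllability of the local
    supervisor then keeps the whole continuation inside its closure
    ([controllable_local_step]).  Output control consistency is a special case of
    local control consistency ([OCC_LCC]), so that a single argument covers both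
    alternatives. *)

Section Languages.
Variable A : finType.
Implicit Types (S T Sk Su : {set A}) (s t u v w x y : seq A) (a : A).
Implicit Types (K L M C : set (seq A)).

(** * Words, projections and prefix closure *)

Lemma words_cat S s t : words S (s ++ t) <-> words S s /\ words S t.
Proof. by rewrite /words /= all_cat; split=> /andP. Qed.

Lemma words_rcons S s a : words S (rcons s a) <-> a \in S /\ words S s.
Proof. by rewrite /words /= all_rcons; split=> /andP. Qed.

Lemma words_sub S T w : S \subset T -> words S w -> words T w.
Proof. by move=> ST /allP Sw; apply/allP => a /Sw /(fintype.subsetP ST). Qed.

Lemma proj_cat S s t : proj S (s ++ t) = proj S s ++ proj S t.
Proof. exact: filter_cat. Qed.

Lemma proj_rcons S s a :
  proj S (rcons s a) = if a \in S then rcons (proj S s) a else proj S s.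
Proof. exact: filter_rcons. Qed.

Lemma proj_setI S T w : proj (S :&: T) w = proj S (proj T w).
Proof.
by rewrite /proj -filter_predI; apply: eq_filter => a; rewrite /= finset.in_setI.
Qed.

Lemma proj_id S w : words S w -> proj S w = w.
Proof. by move=> Sw; apply/all_filterP. Qed.

Lemma proj_words_setI S T w : words T w -> proj S w = proj (S :&: T) w.
Proof. by move=> Tw; rewrite proj_setI (proj_id Tw). Qed.

Lemma proj_sub S T w : S \subset T -> proj S (proj T w) = proj S w.
Proof. by move=> /finset.setIidPl ST; rewrite -proj_setI ST. Qed.

Lemma proj_nil S w : words (~: S) w -> proj S w = [::].
Proof.
move=> /allP Sw; rewrite /proj (eq_in_filter (a2 := pred0)) ?filter_pred0 //.
by move=> a /Sw; rewrite finset.in_setC => /negbTE.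
Qed.

Lemma proj_prefix S s t : prefix s t -> prefix (proj S s) (proj S t).
Proof. by case/prefixP=> u ->; rewrite proj_cat prefix_prefix. Qed.

Lemma pclos_proj S L : pclos (proj S @` L) `<=` proj S @` pclos L.
Proof.
move=> t [_ [w Lw <-] tw].
suff [s sw <-] : exists2 s, prefix s w & proj S s = t by exists s => //; exists w.
elim: w t {Lw} tw => [|a w IHw] t.
  by rewrite prefixs0 => /eqP ->; exists [::].
rewrite /proj /=; case: ifPn => [Sa|nSa].
  case: t => [_|b t /andP[/eqP -> /IHw[s sw <-]]]; first by exists [::].
  by exists (a :: s); rewrite /= ?eqxx ?Sa.
by move=> /IHw[s sw <-]; exists (a :: s); rewrite /= ?eqxx ?(negbTE nSa).
Qed.

Lemma sub_pclos L : L `<=` pclos L.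
Proof. by move=> w Lw; exists w => //; exact: prefix_refl. Qed.

Lemma pclos_idem L : pclos (pclos L) `<=` pclos L.
Proof.
by move=> s [t [w Lw tw] st]; exists w => //; exact: prefix_trans st tw.
Qed.

Lemma pclos_min L M : pclos L `<=` L -> M `<=` L -> pclos M `<=` L.
Proof. by move=> clL ML s [w /ML Lw sw]; apply: clL; exists w. Qed.

Lemma pclos_words S : pclos (words S) `<=` words S.
Proof. by move=> s [w + /prefixP[u Ew]]; rewrite Ew words_cat => -[]. Qed.

Lemma pclos_catl L s t : pclos L `<=` L -> L (s ++ t) -> L s.
Proof.
by move=> clL Lst; apply: clL; exists (s ++ t) => //; exact: prefix_prefix.
Qed.

Lemma pclos_lpar S T L M : pclos L `<=` L -> pclos M `<=` M ->
  pclos (lpar S T L M) `<=` lpar S T L M.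
Proof.
move=> clL clM s [w [STw Lw Mw] /[dup] sw /prefixP[u Ew]]; split.
- by move: STw; rewrite Ew words_cat => -[].
- by apply: clL; exists (proj S w) => //; exact: proj_prefix.
- by apply: clM; exists (proj T w) => //; exact: proj_prefix.
Qed.

Lemma pclos_invproj S T L : pclos L `<=` L ->
  pclos (invproj S T L) `<=` invproj S T L.
Proof.
move=> clL s [w [Sw Lw] /[dup] sw /prefixP[u Ew]]; split.
  by move: Sw; rewrite Ew words_cat => -[].
by apply: clL; exists (proj T w) => //; exact: proj_prefix.
Qed.

(** Events outside the other alphabet are interleaved freely; an event common to
    both alphabets is emitted only when it heads both words, which the equality of
    the projections guarantees once no private event is available. *)
Lemma merge_words S T x y : words S x -> words T y -> proj T x = proj S y ->
  exists w, [/\ words (S :|: T) w, proj S w = x & proj T w = y].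
Proof.
have consP U V w a : a \in U :|: V -> words (U :|: V) w ->
    words (U :|: V) (a :: w) by rewrite /words /= => -> ->.
elim: x y => [|a x IHx] y.
  move=> _ Ty /esym Ey; exists y; split=> //; last exact: proj_id.
  by apply: words_sub Ty; exact: finset.subsetUr.
move=> /[dup] Sax /andP[Sa Sx].
elim: y => [|b y IHy] Ty.
  move=> Ex; exists (a :: x); split=> //; last exact: proj_id.
  by apply: words_sub Sax; exact: finset.subsetUl.
have /andP[Tb Ty'] := Ty.
rewrite /proj /=; case: ifPn => [Ta|nTa]; last first.
  move=> /(IHx (b :: y) Sx Ty)[w [Ww wx wy]]; exists (a :: w); split.
  - by apply: consP => //; rewrite finset.in_setU Sa.
  - by rewrite /= Sa -/(proj S w) wx.
  - by rewrite /= (negbTE nTa).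
case: ifPn => [Sb [<-] {IHy} E|nSb E].
  have [w [Ww wx wy]] := IHx y Sx Ty' E.
  exists (a :: w); split.
  - by apply: consP => //; rewrite finset.in_setU Sa.
  - by rewrite /= Sa -/(proj S w) wx.
  - by rewrite /= Ta -/(proj T w) wy.
have /(IHy Ty')[w [Ww wx wy]] : proj T (a :: x) = proj S y by rewrite /proj /= Ta.
exists (b :: w); split.
- by apply: consP => //; rewrite finset.in_setU Tb orbT.
- by rewrite /= (negbTE nSb).
- by rewrite /= Tb -/(proj T w) wy.
Qed.

Lemma split_last_in S s :
  words (~: S) s \/
  exists s' a v, [/\ s = s' ++ a :: v, a \in S & words (~: S) v].
Proof.
elim/last_ind: s => [|s a IHs]; first by left.
have [Sa|nSa] := boolP (a \in S).
  by right; exists s, a, [::]; rewrite cats1; split.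
case: IHs => [ns|[s' [b [v [-> Sb nv]]]]].
  by left; apply/words_rcons; rewrite finset.in_setC.
right; exists s', b, (rcons v a); split=> //; first by rewrite rcons_cat.
by apply/words_rcons; rewrite finset.in_setC.
Qed.

Lemma split_proj_rcons S s u a : proj S (s ++ u) = rcons (proj S s) a ->
  exists v u', [/\ u = rcons v a ++ u', words (~: S) v & a \in S].
Proof.
rewrite proj_cat -cats1 => /eqP; rewrite eqseq_cat // eqxx /= => /eqP.
elim: u => [//|b u IHu] /=; rewrite /proj /=.
case: ifPn => [Sb [<- _]|nSb /IHu[v [u' [-> nv Sa]]]].
  by exists [::], u.
by exists (b :: v), u'; split=> //; rewrite /words /= finset.in_setC nSb nv.
Qed.

(** * Supremal controllable sublanguages and control consistency *)

Lemma supC_sub K L Su : supC K L Su `<=` K `&` L.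
Proof. by move=> w [M [KM _]] /KM. Qed.

Lemma supC_controllable K L Su : controllable (supC K L Su) L Su.
Proof.
move=> _ [[s [w [M MK Mw] sw] [a Sua] <-] Lsa].
have [|v Mv sv] := MK.2 (rcons s a).
  by split=> //; exists s; [exists w | exists a].
by exists v => //; exists M.
Qed.

Lemma controllable_cat M L Su s v : pclos L `<=` L -> controllable M L Su ->
  pclos M s -> words Su v -> L (s ++ v) -> pclos M (s ++ v).
Proof.
move=> clL cM Ms; elim/last_ind: v => [|v a IHv]; first by rewrite cats0.
rewrite -rcons_cat => /words_rcons[Sua Suv] Lsva; apply: cM; split=> //.
exists (s ++ v); last by exists a.
by apply: IHv => //; move: Lsva; rewrite -cats1; exact: pclos_catl.
Qed.

(** Output control consistency forbids controllable events anywhere in the block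
    of hidden events before an uncontrollable [a]; the hidden part of that block
    following [s] is then uncontrollable too, whichever continuation is chosen. *)
Lemma OCC_LCC S S0 Su L : L `<=` words S -> OCC S S0 Su L -> LCC S S0 Su L.
Proof.
move=> LS occ s Ls a; rewrite finset.in_setI => /andP[S0a Sua] _.
have [[u Su0 Lsua]|no] :=
  pselect (exists2 u, words (S :\: S0) u & L (s ++ rcons u a)); last by left.
right; exists u => //.
have inD v : words S v -> words (~: S0) v -> words (S :\: S0) v.
  move=> /allP Sv /allP nv; apply/allP => b bv.
  by rewrite finset.in_setD Sv // andbT; have := nv _ bv; rewrite finset.in_setC.
suff Suu : words Su u.
  apply/allP => b bu; have := allP Su0 _ bu; rewrite !finset.in_setD => /andP[-> _].
  exact: (allP Suu).
have Ss := LS _ Ls.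
have [ns|[s' [a0 [v [Es S0a0 nv]]]]] := split_last_in S0 s.
  suff /words_cat[] : words Su (s ++ u) by [].
  apply: (occ (s ++ rcons u a) (s ++ u) a) => //; first exact: sub_pclos.
    by left; rewrite rcons_cat.
  by apply/words_cat; split=> //; exact: inD.
move: Ss; rewrite Es => /words_cat[Ss' /andP[_ Sv]].
suff /words_cat[] : words Su (v ++ u) by [].
apply: (occ (s ++ rcons u a) (v ++ u) a) => //; first exact: sub_pclos.
  by right; exists s', a0; rewrite Es rcons_cat -catA.
by apply/words_cat; split=> //; exact: inD.
Qed.

(** Here [L] is the language of the local plant over [S] and [C] the closed
    behaviour imposed by the coordinator.  Along the uncontrollable block that
    precedes [a] the projection to [Sk] does not move, so that [C] stays satisfied
    until [a], which it allows by hypothesis. *)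
Lemma controllable_local_step S Sk Su L C M s a :
  pclos L `<=` L -> pclos C `<=` C -> M `<=` lpar S Sk L C ->
  controllable M (lpar S Sk L C) ((S :|: Sk) :&: Su) ->
  observer (S :|: Sk) Sk (invproj (S :|: Sk) S L) ->
  LCC (S :|: Sk) Sk Su (invproj (S :|: Sk) S L) ->
  pclos M s -> a \in Sk :&: Su -> C (rcons (proj Sk s) a) ->
  (proj Sk @` invproj (S :|: Sk) S L) (rcons (proj Sk s) a) ->
  (proj Sk @` pclos M) (rcons (proj Sk s) a).
Proof.
move=> clL clC ML cM obs lcc Ms Ska Csa Psa.
have clLC := pclos_lpar clL clC (S := S) (T := Sk).
have clI := pclos_invproj clL (S := S :|: Sk) (T := S).
have [Ss Ls Cs] : lpar S Sk L C s by exact: pclos_min Ms.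
have Is : invproj (S :|: Sk) S L s by split.
have [v Sv Isva] :
    exists2 v, words (Su :\: Sk) v & invproj (S :|: Sk) S L (s ++ rcons v a).
  have [//|u [Su' Isu Pu]] := obs _ s Psa (sub_pclos Is).
    by rewrite -cats1; exact: prefix_prefix.
  have [v [u' [Eu nv _]]] := split_proj_rcons Pu.
  have [[]|//] := lcc s Is a Ska Psa; exists v.
    move: Su'; rewrite Eu => /words_cat[/words_rcons[_ Sv] _].
    apply/allP => b bv; rewrite finset.in_setD (allP Sv) // andbT.
    by have := allP nv _ bv; rewrite finset.in_setC.
  by apply: (pclos_catl (t := u')) => //; rewrite -catA -Eu.
move: Ska; rewrite finset.in_setI => /andP[Ska Sua].
have Pv : proj Sk (s ++ rcons v a) = rcons (proj Sk s) a.
  rewrite proj_cat proj_rcons Ska (proj_nil (w := v)) ?cats1 //.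
  by apply: words_sub Sv; rewrite finset.setDE finset.subsetIr.
exists (s ++ rcons v a) => //.
have [Ssva Lsva] := Isva.
apply: controllable_cat (cM) Ms _ _ => //.
  move/words_cat: Ssva => [_ /allP Sva]; apply/allP => b bv.
  rewrite /= finset.in_setI Sva //=; move: bv; rewrite mem_rcons inE.
  by case/predU1P=> [->//|/(allP Sv)]; rewrite finset.in_setD => /andP[].
by split=> //; rewrite Pv.
Qed.

(** * Synchronization over the shared events *)

(** [Sk] being exactly the set of shared events, words of the two closures with
    the same projection merge into a word of the product of the closures, which
    nonconflictingness lets one complete to a word of the product itself. *)
Lemma pclos_setI_proj S T Sk M1 M2 t : S :&: T = Sk ->
  M1 `<=` words S -> M2 `<=` words T -> nonconflicting S T M1 M2 ->
  (proj Sk @` pclos M1) t -> (proj Sk @` pclos M2) t ->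
  pclos ((proj Sk @` M1) `&` (proj Sk @` M2)) t.
Proof.
move=> ESk M1S M2T nc [x M1x Px] [y M2y Py].
have Sx : words S x by apply: pclos_min M1x => //; exact: pclos_words.
have Ty : words T y by apply: pclos_min M2y => //; exact: pclos_words.
have [|w [STw wx wy]] := merge_words Sx Ty.
  by rewrite (proj_words_setI T Sx) (proj_words_setI S Ty) finset.setIC ESk Px.
have : lpar S T (pclos M1) (pclos M2) w by split; rewrite ?wx ?wy.
rewrite -nc => -[w' [_ M1w' M2w'] ww']; exists (proj Sk w').
  have [SkS SkT] : Sk \subset S /\ Sk \subset T.
    by rewrite -ESk finset.subsetIl finset.subsetIr.
  by split; [exists (proj S w') | exists (proj T w')]; rewrite ?proj_sub.
rewrite -Px -wx proj_sub ?proj_prefix // -ESk.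
exact: finset.subsetIl.
Qed.

(** The inclusion assumed of the language of the coordinator constrains words over
    [S :&: Sk] only; merging turns it into the membership in a projected plant
    language over [S :|: Sk] that the observer property asks for. *)
Lemma proj_invproj_surj S Sk L t : L `<=` words S -> words Sk t ->
  (proj Sk @` L) (proj (S :&: Sk) t) ->
  (proj Sk @` invproj (S :|: Sk) S L) t.
Proof.
move=> LS Skt [x Lx Px].
have [|w [Sw wx wt]] := merge_words (LS _ Lx) Skt.
  by rewrite Px proj_setI (proj_id Skt).
by exists w => //; split=> //=; rewrite wx.
Qed.

End Languages.

(** * Languages of generators *)

Section Generators.
Variables (A : finType) (S : {set A}) (G : generator S).

Lemma run_cat (q : G) s t : run q (s ++ t) = obind (fun p => run p t) (run q s).
Proof. by elim: s q => //= a s IHs q; case: (trans q a). Qed.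

Lemma lang_words : lang G `<=` words S.
Proof.
rewrite /lang /words => w /=; elim: w (init G) => //= a w IHw q.
case: (boolP (a \in S)) => [_|/trans_out -> //].
by case: (trans q a) => //= p; exact: IHw.
Qed.

Lemma pclos_lang : pclos (lang G) `<=` lang G.
Proof.
move=> s [w Gw /prefixP[u Ew]]; move: Gw; rewrite Ew /lang /= run_cat.
by case: (run _ s).
Qed.

End Generators.

(** * The coordinator and one component *)

(** The coordinator's supervisor [Ck] allows [a] after [t] because it is
    controllable for [Gk], and [t] is in its closure because every word of [M]
    projects into that closure. *)
Lemma supC_proj_step (A : finType) (S Sk Su : {set A}) (G : generator S)
    (Gk : generator Sk) (K Kk : set (seq A)) t a :
  let Ck := supC Kk (lang Gk) (Sk :&: Su) in
  let M := supC K (lpar S Sk (lang G) (pclos Ck)) ((S :|: Sk) :&: Su) in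
  let L := invproj (S :|: Sk) S (lang G) in
  observer (S :|: Sk) Sk L -> LCC (S :|: Sk) Sk Su L ->
  pclos (proj Sk @` M) t -> a \in Sk :&: Su -> lang Gk (rcons t a) ->
  (proj Sk @` lang G) (proj (S :&: Sk) (rcons t a)) ->
  (proj Sk @` pclos M) (rcons t a).
Proof.
move=> Ck M L obs lcc /pclos_proj[s Ms <-] Ska Gksa Gsa.
have cl := @pclos_idem _ Ck.
have ML : M `<=` lpar S Sk (lang G) (pclos Ck) by move=> w Mw; have [] := supC_sub Mw.
have [_ _ Cs] : lpar S Sk (lang G) (pclos Ck) s.
  by apply: pclos_min Ms => //; apply: pclos_lpar => //; exact: pclos_lang.
apply: (controllable_local_step _ cl ML _ obs lcc Ms Ska) => //.
- exact: pclos_lang.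
- exact: supC_controllable.
- apply: (supC_controllable (L := lang Gk)); split=> //.
  by exists (proj Sk s) => //; exists a => //; exact: Ska.
- by apply: proj_invproj_surj => //; [exact: lang_words | exact: lang_words Gksa].
Qed.

Theorem corollary10 (A : finType) (S1 S2 Sk Sc Su : {set A})
  (G1 : generator S1) (G2 : generator S2) (Gk : generator Sk)
  (K : set (seq A))
  (S1_neq0 : S1 != finset.set0) (S2_neq0 : S2 != finset.set0)
  (Sk_neq0 : Sk != finset.set0)
  (Scu_cover : Sc :|: Su = S1 :|: S2) (Scu_disjoint : Sc :&: Su = finset.set0)
  (sub_Sk : S1 :&: S2 \subset Sk) (Sk_sub : Sk \subset S1 :|: S2)
  (Gk_sub : lang Gk `<=`
     lpar (S1 :&: Sk) (S2 :&: Sk) (proj Sk @` lang G1) (proj Sk @` lang G2))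
  (K_regular : regular (S1 :|: S2) K)
  (K_sub : K `<=` mlang (gpar (gpar G1 G2) Gk))
  (K_cd : cond_decomposable S1 S2 Sk K)
  (clK_cd : cond_decomposable S1 S2 Sk (pclos K)) :
  let S1k := S1 :|: Sk in
  let S2k := S2 :|: Sk in
  let supCk := supC (proj Sk @` K) (lang Gk) (Sk :&: Su) in
  let supC1k := supC (proj S1k @` K)
    (lpar S1 Sk (lang G1) (pclos supCk)) (S1k :&: Su) in
  let supC2k := supC (proj S2k @` K)
    (lpar S2 Sk (lang G2) (pclos supCk)) (S2k :&: Su) in
  nonconflicting S1k S2k supC1k supC2k ->
  observer S1k Sk (invproj S1k S1 (lang G1)) ->
  observer S2k Sk (invproj S2k S2 (lang G2)) ->
  (OCC S1k Sk Su (invproj S1k S1 (lang G1)) /\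
   OCC S2k Sk Su (invproj S2k S2 (lang G2))) \/
  (LCC S1k Sk Su (invproj S1k S1 (lang G1)) /\
   LCC S2k Sk Su (invproj S2k S2 (lang G2))) ->
  controllable ((proj Sk @` supC1k) `&` (proj Sk @` supC2k))
    (lang Gk) (Sk :&: Su).
Proof.
move=> S1k S2k supCk supC1k supC2k nc obs1 obs2 ctl.
have [lcc1 lcc2] : LCC S1k Sk Su (invproj S1k S1 (lang G1)) /\
    LCC S2k Sk Su (invproj S2k S2 (lang G2)).
  by case: ctl => // -[occ1 occ2]; split; apply: OCC_LCC => // w [].
have ESk : S1k :&: S2k = Sk.
  by rewrite /S1k /S2k -finset.setUIl; apply/finset.setUidPr.
have supC_words S M C : supC M (lpar S Sk C (pclos supCk)) ((S :|: Sk) :&: Su)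
    `<=` words (S :|: Sk) by move=> w Mw; have [_ []] := supC_sub Mw.
move=> _ [[t [w [M1w M2w] tw] [a Ska <-]] Gkta].
have [_ G1ta G2ta] := Gk_sub _ Gkta.
apply: (pclos_setI_proj ESk) => //; try exact: supC_words.
- by apply: (supC_proj_step obs1 lcc1 _ Ska Gkta G1ta); exists w.
- by apply: (supC_proj_step obs2 lcc2 _ Ska Gkta G2ta); exists w.
Qed.
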